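(* Consider an execution of the DRL transition system and a time $t$. Let $S$ be a set of actors that is closed at time $t$ and all of whose actors are terminated at time $t$, and let $Q$ be a set of snapshots with $\mathrm{dom}(Q)=S$ that is consistent at time $t$. Then $Q$ is finalized.
   Context: DRL transition system. Refobs are triples $x: A\to B$ (token $x$, owner $A$, target $B$). Facts: $\mathrm{Created}(x)$, $\mathrm{Released}(x)$, $\mathrm{CreatedUsing}(x,y)$, $\mathrm{Activated}(x)$, $\mathrm{Unreleased}(x)$, $\mathrm{SentCount}(x,n)$, $\mathrm{RecvCount}(x,n)$. A knowledge set $\Phi$ is a finite set of facts; $\Phi\vdash\varphi$ means derivability in first-order logic plus: if no $\mathrm{SentCount}(x,n)\in\Phi$ then $\Phi\vdash\mathrm{SentCount}(x,0)$; likewise for $\mathrm{RecvCount}$; $\Phi\vdash\mathrm{Created}(x)\wedge\neg\mathrm{Released}(x)$ gives $\Phi\vdash\mathrm{Unreleased}(x)$; $\Phi\vdash\mathrm{CreatedUsing}(x,y)$ gives $\Phi\vdash\mathrm{Created}(y)$. $\mathrm{IncSent}/\mathrm{IncRecv}(x,\Phi)$ increment (or create with value $1$) the corresponding count. Messages: $\mathrm{App}(x,R)$, $\mathrm{Info}(y,z,B)$, $\mathrm{Release}(x,n)$. A configuration $(\alpha,\mu,\rho,\chi)$: $\alpha$ maps internal actors to busy $[\Phi]$ or idle $(\Phi)$ states; $\mu$ gives undelivered messages of each actor; receptionists $\rho\subseteq\mathrm{dom}(\alpha)$; external actors $\chi$. Initial configuration: one busy actor $A$ with $\{\mathrm{Activated}(x:A\to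 E),\mathrm{Created}(y:A\to A),\mathrm{Activated}(y:A\to A)\}$, no messages, $\rho=\emptyset$, $\chi=\{E\}$. Events: Spawn$(x,A,B)$: busy $A$, fresh $x,y,B$; $A$ adds $\mathrm{Activated}(x:A\to B)$; new busy $B$ with $\{\mathrm{Created}(x:A\to B),\mathrm{Created}(y:B\to B),\mathrm{Activated}(y:B\to B)\}$. Send$(x,\vec y,\vec z,A,B,\vec C)$: busy $A$ with $\Phi\vdash\mathrm{Activated}(x:A\to B)$ and $\Phi\vdash\mathrm{Activated}(y_i:A\to C_i)$, fresh $z_i$; $A$'s set becomes $\mathrm{IncSent}(x,\Phi)\cup\{\mathrm{CreatedUsing}(y_i,z_i)\}$; $\mathrm{App}(x,\{z_i:B\to C_i\})$ sent to $B$. Receive$(x,B,R)$: idle $B$ consumes $\mathrm{App}(x,R)$, becomes busy with $\mathrm{IncRecv}(x,\Phi)\cup\{\mathrm{Activated}(z):z\in R\}$. Idle$(A)$: busy $A$ becomes idle. SendInfo$(y,z,A,B,C)$: busy $A$ containing $\mathrm{CreatedUsing}(y:A\to C,z:B\to C)$ removes it, increments send count of $y$, sends $\mathrm{Info}(y,z,B)$ to $C$. Info$(y,z,B,C)$: idle $C$ consumes it, stays idle with $\mathrm{IncRecv}(y,\Phi)\cup\{\mathrm{Created}(z:B\to C)\}$. SendRelease$(x,A,B)$: busy $A$ with set $\Phi\cup\{\mathrm{Activated}(x:A\to B),\mathrm{SentCount}(x,n)\}$, no $\mathrm{CreatedUsing}(x,y)\in\Phi$: set becomes $\Phi$; sends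 $\mathrm{Release}(x,n)$ to $B$. Release$(x,A,B)$: idle $B$ consumes $\mathrm{Release}(x,n)$ only if $\Phi\vdash\mathrm{RecvCount}(x,n)$; adds $\mathrm{Released}(x)$; $x$ is released. Compaction$(x,B,C)$: idle $C$ containing $\mathrm{Created}(x:B\to C),\mathrm{Released}(x)$ removes them and any $\mathrm{RecvCount}(x,n)$. Snapshot$(A,\Phi)$: idle $A$; no change; records $\Phi$ as $A$'s snapshot. In$(x,A,R)$: $A\in\rho$ receives from outside $\mathrm{App}(x,R)$ with fresh refobs owned by $A$ whose internal targets lie in $\rho$; external targets join $\chi$. Out$(x,B,R)$: $B\in\chi$ consumes $\mathrm{App}(x,R)$; internal targets of $R$ join $\rho$. ReleaseOut/InfoOut: Release/Info messages to external actors are dropped. Times index the configurations $\kappa_t$ of an execution; $\alpha_t$ is the first component of $\kappa_t$. A refob is unreleased once created until its target performs Release for it. A set $S$ is closed at time $t$ if $B\in S$ and $x:A\to B$ unreleased at time $t$ imply $A\in S$. An actor is terminated at time $t$ if it is idle in $\kappa_t$ and no finite sequence of events from $\kappa_t$ leads to a configuration where it has an undelivered message. A set of snapshots $Q$ maps actors to knowledge sets recorded by their Snapshot events (at most one per actor). $Q$ is consistent at time $t$ if for all facts $\varphi$ and $A\in\mathrm{dom}(Q)$, $Q(A)\vdash\varphi$ iff $\alpha_t(A)\vdash\varphi$. For a refob $x:A\to B$: $Q\vdash\mathrm{Activated}(x)$, $Q\vdash\mathrm{SentCount}(x,n)$, $Q\vdash\mathrm{CreatedUsing}(x,y)$ mean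 $A\in\mathrm{dom}(Q)$ and $Q(A)$ derives the fact; $Q\vdash\mathrm{Created}(x)$, $Q\vdash\mathrm{Released}(x)$, $Q\vdash\mathrm{RecvCount}(x,n)$ mean $B\in\mathrm{dom}(Q)$ and $Q(B)$ derives the fact. $Q\vdash\mathrm{Chain}(x:A\to B)$ iff there are refobs $x_1:A_1\to B,\dots,x_n:A_n\to B$ with $Q\vdash\mathrm{Created}(x_1)$, $Q\not\vdash\mathrm{Released}(x_1)$, and for all $i<n$, $Q\vdash\mathrm{CreatedUsing}(x_i,x_{i+1})$ and $Q\not\vdash\mathrm{Released}(x_{i+1})$, and $A_n=A$, $x_n=x$. $Q\vdash\mathrm{Relevant}(x)$ iff for some $n$, $Q\vdash\mathrm{Activated}(x)$, $Q\vdash\mathrm{SentCount}(x,n)$ and $Q\vdash\mathrm{RecvCount}(x,n)$. $Q$ is finalized if for all $B\in\mathrm{dom}(Q)$ and all refobs $x:A\to B$, $Q\vdash\mathrm{Chain}(x)$ implies $A\in\mathrm{dom}(Q)$ and $Q\vdash\mathrm{Relevant}(x)$. *)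

(* Defs.v *)
From HB Require Import structures.
From mathcomp Require Import all_boot.
From mathcomp Require Import finmap multiset.

Set Implicit Arguments.
Unset Strict Implicit.
Unset Printing Implicit Defensive.

Local Open Scope fset_scope.
Local Open Scope fmap_scope.

(* Tokens and actor addresses range over countably infinite sets of names. *)
Definition token := nat.
Definition addr := nat.

(* [Refob x A B] is the refob x : A -> B. *)
Record refob := Refob { tok : token; owner : addr; target : addr }.

Definition refob_code (r : refob) : token * addr * addr :=
  (tok r, owner r, target r).
Definition refob_decode (c : token * addr * addr) : refob :=
  let: (x, A, B) := c in Refob x A B.
Lemma refob_codeK : cancel refob_code refob_decode.
Proof. by case. Qed.
HB.instance Definition _ := Countable.copy refob (can_type refob_codeK).

Inductive fact :=
| Created of refob
| Released of refob
| CreatedUsing of refob & refob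
| Activated of refob
| Unreleased of refob
| SentCount of refob & nat
| RecvCount of refob & nat.

Definition fact_code (f : fact) : nat * refob * (refob + nat) :=
  match f with
  | Created x => (0, x, inr 0)
  | Released x => (1, x, inr 0)
  | CreatedUsing x y => (2, x, inl y)
  | Activated x => (3, x, inr 0)
  | Unreleased x => (4, x, inr 0)
  | SentCount x n => (5, x, inr n)
  | RecvCount x n => (6, x, inr n)
  end.
Definition fact_decode (c : nat * refob * (refob + nat)) : option fact :=
  match c with
  | (0, x, _) => Some (Created x)
  | (1, x, _) => Some (Released x)
  | (2, x, inl y) => Some (CreatedUsing x y)
  | (3, x, _) => Some (Activated x)
  | (4, x, _) => Some (Unreleased x)
  | (5, x, inr n) => Some (SentCount x n)
  | (6, x, inr n) => Some (RecvCount x n)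
  | _ => None
  end.
Lemma fact_codeK : pcancel fact_code fact_decode.
Proof. by case. Qed.
HB.instance Definition _ := Countable.copy fact (pcan_type fact_codeK).

Definition knowledge := {fset fact}.

(* Derivability of facts.  Negation is by absence: no rule concludes a
   [Released] fact except the axiom rule, so the premise
   [Released x \notin Phi] is the underivability of [Released x]. *)
Inductive derives (Phi : knowledge) : fact -> Prop :=
| derives_ax f : f \in Phi -> derives Phi f
| derives_sent0 x :
    (forall n, SentCount x n \notin Phi) -> derives Phi (SentCount x 0)
| derives_recv0 x :
    (forall n, RecvCount x n \notin Phi) -> derives Phi (RecvCount x 0)
| derives_unreleased x :
    derives Phi (Created x) -> Released x \notin Phi ->
    derives Phi (Unreleased x)
| derives_created x y :
    derives Phi (CreatedUsing x y) -> derives Phi (Created y).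

Definition is_sent (x : refob) (f : fact) : bool :=
  if f is SentCount y _ then y == x else false.
Definition is_recv (x : refob) (f : fact) : bool :=
  if f is RecvCount y _ then y == x else false.
Definition is_created_using (x : refob) (f : fact) : bool :=
  if f is CreatedUsing y _ then y == x else false.

Definition bump_sent (x : refob) (f : fact) : fact :=
  if f is SentCount y n then SentCount y (if y == x then n.+1 else n) else f.
Definition bump_recv (x : refob) (f : fact) : fact :=
  if f is RecvCount y n then RecvCount y (if y == x then n.+1 else n) else f.

Definition IncSent (x : refob) (Phi : knowledge) : knowledge :=
  if has (is_sent x) Phi then [fset bump_sent x f | f in Phi]
  else SentCount x 1 |` Phi.
Definition IncRecv (x : refob) (Phi : knowledge) : knowledge :=
  if has (is_recv x) Phi then [fset bump_recv x f | f in Phi]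
  else RecvCount x 1 |` Phi.

Inductive message :=
| MApp of refob & {fset refob}
| MInfo of refob & refob & addr
| MRelease of refob & nat.

Definition message_code (m : message) :
    (refob * {fset refob}) + (refob * refob * addr) + (refob * nat) :=
  match m with
  | MApp x R => inl (inl (x, R))
  | MInfo y z B => inl (inr (y, z, B))
  | MRelease x n => inr (x, n)
  end.
Definition message_decode
    (c : (refob * {fset refob}) + (refob * refob * addr) + (refob * nat)) :
    message :=
  match c with
  | inl (inl (x, R)) => MApp x R
  | inl (inr (y, z, B)) => MInfo y z B
  | inr (x, n) => MRelease x n
  end.
Lemma message_codeK : cancel message_code message_decode.
Proof. by case. Qed.
HB.instance Definition _ := Choice.copy message (can_type message_codeK).

Inductive actor_state :=
| Busy of knowledge
| Idle of knowledge.

Definition facts_of (s : actor_state) : knowledge :=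
  match s with Busy Phi => Phi | Idle Phi => Phi end.

Definition messages := addr -> {mset message}%mset.

Definition no_messages : messages := fun=> mset0.
Definition post (mu : messages) (A : addr) (m : message) : messages :=
  fun B => if B == A then (m +` mu B)%mset else mu B.
Definition take_msg (mu : messages) (A : addr) (m : message) : messages :=
  fun B => if B == A then (mu B `\ m)%mset else mu B.

Record config := Config {
  actors : {fmap addr -> actor_state};
  undelivered : messages;
  receptionists : {fset addr};
  externals : {fset addr}
}.

Definition initial (x y : token) (A E : addr) : config :=
  Config
    [fmap].[A <- Busy [fset Activated (Refob x A E);
                            Created (Refob y A A);
                            Activated (Refob y A A)]]
    no_messages fset0 [fset E].

Definition refobs_of_fact (f : fact) : seq refob :=
  match f with
  | Created x | Released x | Activated x | Unreleased x => [:: x]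
  | CreatedUsing x y => [:: x; y]
  | SentCount x _ | RecvCount x _ => [:: x]
  end.

Definition refobs_of_message (m : message) : seq refob :=
  match m with
  | MApp x R => x :: R
  | MInfo y z _ => [:: y; z]
  | MRelease x _ => [:: x]
  end.

Definition occurs (r : refob) (k : config) : Prop :=
  (exists A s f, [/\ (actors k).[? A] = Some s,
                     f \in facts_of s & r \in refobs_of_fact f])
  \/ (exists A m, m \in undelivered k A /\ r \in refobs_of_message m).

Definition token_in (x : token) (k : config) : Prop :=
  exists r, occurs r k /\ tok r = x.

Definition addr_in (A : addr) (k : config) : Prop :=
  [\/ A \in domf (actors k),
      A \in externals k
    | exists r, occurs r k /\ (owner r = A \/ target r = A)].

(* A name is fresh when it occurs nowhere in the past of the execution; a
   token that has been compacted away is never reused. *)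
Definition history := config -> Prop.
Definition fresh_token (h : history) (x : token) : Prop :=
  forall k, h k -> ~ token_in x k.
Definition fresh_addr (h : history) (A : addr) : Prop :=
  forall k, h k -> ~ addr_in A k.

(* Parameters are tokens when the other parameters determine the owner and
   the target of the refob. *)
Inductive event :=
| EvSpawn (x y : token) (A B : addr)
| EvSend (x : token) (ys zs : seq token) (A B : addr) (Cs : seq addr)
| EvReceive (x : refob) (B : addr) (R : {fset refob})
| EvIdle (A : addr)
| EvSendInfo (y z : token) (A B C : addr)
| EvInfo (y z : refob) (B C : addr)
| EvSendRelease (x : token) (A B : addr)
| EvRelease (x : token) (A B : addr)
| EvCompaction (x : token) (B C : addr)
| EvSnapshot (A : addr) (Phi : knowledge)
| EvIn (x : refob) (A : addr) (R : {fset refob})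
| EvOut (x : refob) (B : addr) (R : {fset refob})
| EvReleaseOut (x : refob) (B : addr)
| EvInfoOut (y z : refob) (B C : addr).

(* The refobs x_i : A -> B_i for tokens x_i and targets B_i. *)
Definition refobs (xs : seq token) (A : addr) (Bs : seq addr) : seq refob :=
  [seq Refob p.1 A p.2 | p <- zip xs Bs].

Implicit Types (al : {fmap addr -> actor_state}) (mu : messages).
Implicit Types (rho chi : {fset addr}) (Phi : knowledge) (R : {fset refob}).

Inductive step (h : history) : config -> event -> config -> Prop :=
| step_spawn al mu rho chi x y A B Phi :
    al.[? A] = Some (Busy Phi) ->
    fresh_token h x -> fresh_token h y -> x != y -> fresh_addr h B ->
    step h (Config al mu rho chi)
      (EvSpawn x y A B)
      (Config
        al.[A <- Busy (Activated (Refob x A B) |` Phi)]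
          .[B <- Busy [fset Created (Refob x A B); Created (Refob y B B);
                            Activated (Refob y B B)]]
        mu rho chi)
| step_send al mu rho chi x ys zs A B Cs Phi :
    al.[? A] = Some (Busy Phi) ->
    derives Phi (Activated (Refob x A B)) ->
    size ys = size Cs -> size zs = size Cs ->
    (forall r, r \in refobs ys A Cs -> derives Phi (Activated r)) ->
    uniq zs -> (forall z, z \in zs -> fresh_token h z) ->
    step h (Config al mu rho chi)
      (EvSend x ys zs A B Cs)
      (Config
        al.[A <- Busy (IncSent (Refob x A B) Phi `|`
                       [fset f in [seq CreatedUsing p.1 p.2 |
                            p <- zip (refobs ys A Cs) (refobs zs B Cs)]])]
        (post mu B (MApp (Refob x A B) [fset z in refobs zs B Cs]))
        rho chi)
| step_receive al mu rho chi x B R Phi :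
    al.[? B] = Some (Idle Phi) ->
    MApp x R \in mu B ->
    step h (Config al mu rho chi)
      (EvReceive x B R)
      (Config
        al.[B <- Busy (IncRecv x Phi `|` [fset Activated z | z in R])]
        (take_msg mu B (MApp x R)) rho chi)
| step_idle al mu rho chi A Phi :
    al.[? A] = Some (Busy Phi) ->
    step h (Config al mu rho chi)
      (EvIdle A)
      (Config al.[A <- Idle Phi] mu rho chi)
| step_send_info al mu rho chi y z A B C Phi :
    al.[? A] = Some (Busy Phi) ->
    CreatedUsing (Refob y A C) (Refob z B C) \in Phi ->
    step h (Config al mu rho chi)
      (EvSendInfo y z A B C)
      (Config
        al.[A <- Busy (IncSent (Refob y A C)
                  (Phi `\ CreatedUsing (Refob y A C) (Refob z B C)))]
        (post mu C (MInfo (Refob y A C) (Refob z B C) B)) rho chi)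
| step_info al mu rho chi y z B C Phi :
    al.[? C] = Some (Idle Phi) ->
    MInfo y z B \in mu C ->
    step h (Config al mu rho chi)
      (EvInfo y z B C)
      (Config
        al.[C <- Idle (Created z |` IncRecv y Phi)]
        (take_msg mu C (MInfo y z B)) rho chi)
| step_send_release al mu rho chi x A B n Phi :
    al.[? A] = Some (Busy Phi) ->
    Activated (Refob x A B) \in Phi ->
    SentCount (Refob x A B) n \in Phi ->
    ~~ has (is_created_using (Refob x A B)) Phi ->
    step h (Config al mu rho chi)
      (EvSendRelease x A B)
      (Config
        al.[A <- Busy (Phi `\ Activated (Refob x A B)
                           `\ SentCount (Refob x A B) n)]
        (post mu B (MRelease (Refob x A B) n)) rho chi)
| step_release al mu rho chi x A B n Phi :
    al.[? B] = Some (Idle Phi) ->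
    MRelease (Refob x A B) n \in mu B ->
    derives Phi (RecvCount (Refob x A B) n) ->
    step h (Config al mu rho chi)
      (EvRelease x A B)
      (Config
        al.[B <- Idle (Released (Refob x A B) |` Phi)]
        (take_msg mu B (MRelease (Refob x A B) n)) rho chi)
| step_compaction al mu rho chi x B C Phi :
    al.[? C] = Some (Idle Phi) ->
    Created (Refob x B C) \in Phi ->
    Released (Refob x B C) \in Phi ->
    step h (Config al mu rho chi)
      (EvCompaction x B C)
      (Config
        al.[C <- Idle [fset f in Phi `\ Created (Refob x B C)
                                     `\ Released (Refob x B C)
                            | ~~ is_recv (Refob x B C) f]]
        mu rho chi)
| step_snapshot al mu rho chi A Phi :
    al.[? A] = Some (Idle Phi) ->
    step h (Config al mu rho chi)
      (EvSnapshot A Phi)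
      (Config al mu rho chi)
(* The refob x along which an outside message arrives belongs to an actor
   outside the system; it need not be new. *)
| step_in al mu rho chi x A R :
    A \in rho ->
    target x = A -> owner x \notin domf al ->
    {in R &, injective tok} ->
    (forall r, r \in R -> [/\ fresh_token h (tok r), tok r != tok x,
                              owner r = A &
                              target r \in domf al -> target r \in rho]) ->
    step h (Config al mu rho chi)
      (EvIn x A R)
      (Config al
        (post mu A (MApp x R)) rho
        (chi `|` [fset B in [fset target r | r in R] | B \notin domf al]))
| step_out al mu rho chi x B R :
    B \in chi ->
    MApp x R \in mu B ->
    step h (Config al mu rho chi)
      (EvOut x B R)
      (Config al
        (take_msg mu B (MApp x R))
        (rho `|` [fset C in [fset target r | r in R] | C \in domf al])
        chi)
| step_release_out al mu rho chi x n B :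
    B \in chi ->
    MRelease x n \in mu B ->
    step h (Config al mu rho chi)
      (EvReleaseOut x B)
      (Config al (take_msg mu B (MRelease x n)) rho chi)
| step_info_out al mu rho chi y z B C :
    C \in chi ->
    MInfo y z B \in mu C ->
    step h (Config al mu rho chi)
      (EvInfoOut y z B C)
      (Config al (take_msg mu C (MInfo y z B)) rho chi).

(* [run h k es k']: the finite sequence of events es leads from k to k', where
   h holds of the configurations up to and including k. *)
Inductive run : history -> config -> seq event -> config -> Prop :=
| run_nil h k : run h k [::] k
| run_cons h k e k1 es k' :
    step h k e k1 ->
    run (fun c => h c \/ c = k1) k1 es k' ->
    run h k (e :: es) k'.

(* [ev t] is the event from [conf t] to [conf t.+1].  A finite execution is
   padded: once [ev] is [None] it stays so and the configuration is constant. *)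
Record execution := Execution {
  conf : nat -> config;
  ev : nat -> option event;
  conf_init : exists x y A E, [/\ x != y, A != E & conf 0 = initial x y A E];
  conf_step : forall t,
    match ev t with
    | Some e => step (fun c => exists2 i, i <= t & c = conf i)
                     (conf t) e (conf t.+1)
    | None => ev t.+1 = None /\ conf t.+1 = conf t
    end
}.

Definition past (E : execution) (t : nat) : history :=
  fun c => exists2 i, i <= t & c = conf E i.

Definition creates (e : event) : seq refob :=
  match e with
  | EvSpawn x y A B => [:: Refob x A B; Refob y B B]
  | EvSend _ _ zs _ B Cs => refobs zs B Cs
  | EvIn _ _ R => R
  | _ => [::]
  end.

Definition created_by (E : execution) (t : nat) (r : refob) : Prop :=
  occurs r (conf E 0) \/
  exists i e, [/\ i < t, ev E i = Some e & r \in creates e].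

Definition released_by (E : execution) (t : nat) (r : refob) : Prop :=
  exists2 i, i < t & ev E i = Some (EvRelease (tok r) (owner r) (target r)).

Definition unreleased (E : execution) (t : nat) (r : refob) : Prop :=
  created_by E t r /\ ~ released_by E t r.

Definition closed_at (E : execution) (t : nat) (S : {fset addr}) : Prop :=
  forall r, target r \in S -> unreleased E t r -> owner r \in S.

Definition terminated_at (E : execution) (t : nat) (A : addr) : Prop :=
  (exists Phi, (actors (conf E t)).[? A] = Some (Idle Phi)) /\
  ~ (exists es k, run (past E t) (conf E t) es k /\ undelivered k A != mset0).

Definition snapshots := {fmap addr -> knowledge}.

Definition recorded_in (E : execution) (Q : snapshots) : Prop :=
  forall A Phi, Q.[? A] = Some Phi ->
    exists i, ev E i = Some (EvSnapshot A Phi).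

Definition consistent_at (E : execution) (t : nat) (Q : snapshots) : Prop :=
  forall A Phi, Q.[? A] = Some Phi ->
    exists2 s, (actors (conf E t)).[? A] = Some s &
      forall f, derives Phi f <-> derives (facts_of s) f.

(* The actor whose snapshot is consulted for a fact. *)
Definition holder (f : fact) : addr :=
  match f with
  | Activated x | SentCount x _ | CreatedUsing x _ => owner x
  | Created x | Released x | RecvCount x _ | Unreleased x => target x
  end.

Definition Qderives (Q : snapshots) (f : fact) : Prop :=
  exists2 Phi, Q.[? holder f] = Some Phi & derives Phi f.

(* The chain r 0, ..., r n; all its refobs have the target of x. *)
Definition Chain (Q : snapshots) (x : refob) : Prop :=
  exists (n : nat) (r : nat -> refob),
    [/\ forall i, i <= n -> target (r i) = target x,
        Qderives Q (Created (r 0)) /\ ~ Qderives Q (Released (r 0)),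
        forall i, i < n -> Qderives Q (CreatedUsing (r i) (r i.+1)) /\
                           ~ Qderives Q (Released (r i.+1))
      & r n = x].

Definition Relevant (Q : snapshots) (x : refob) : Prop :=
  exists n, [/\ Qderives Q (Activated x), Qderives Q (SentCount x n)
              & Qderives Q (RecvCount x n)].

Definition finalized (Q : snapshots) : Prop :=
  forall x, target x \in domf Q -> Chain Q x ->
    owner x \in domf Q /\ Relevant Q x.

(* Main.v *)
(* Two one-shot resources are attached to each refob r : A -> B.  The evidence of
   its creation moves from a CreatedUsing fact to an Info message to a Created
   fact of B; the right to use it moves from an App message to an Activated fact
   of A to a Release message to a Released fact of B.  Uniqueness of the first
   implies that once r is released, either B still knows Released(r) or no
   evidence of the creation of r is left; hence every refob of a chain is
   unreleased, and closedness puts its owner in S.  As long as the right to use r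
   is pending or held by A, the send count at A equals the receive count at B
   plus the number of messages in transit along r.  Actors in S are terminated,
   so nothing is in transit to A or B: the right to use the unreleased refob r
   can only be an Activated fact of A, and the two counts agree. *)
Require Import Defs.
From mathcomp Require Import all_boot.
From mathcomp Require Import finmap multiset.
From mathcomp Require Import zify.

Set Implicit Arguments.
Unset Strict Implicit.
Unset Printing Implicit Defensive.

Local Open Scope fset_scope.
Local Open Scope nat_scope.

(** * Knowledge sets and message counts *)

Definition know (al : {fmap addr -> actor_state}) (A : addr) : knowledge :=
  if al.[? A]%fmap is Some s then facts_of s else fset0.

Definition cnt (p : pred message) (mu : messages) (A : addr) : nat :=
  count p (mu A).

Definition carries (r : refob) (m : message) : bool :=
  if m is MApp _ R then r \in R else false.
Definition informs (r : refob) (m : message) : bool :=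
  if m is MInfo _ z _ then z == r else false.
Definition releases (r : refob) (m : message) : bool :=
  if m is MRelease x _ then x == r else false.
(** An [Info] message travels along its first refob: sending and receiving it increments the counts
    of that refob. *)
Definition sent_along (r : refob) (m : message) : bool :=
  match m with
  | MApp x _ => x == r
  | MInfo y _ _ => y == r
  | MRelease _ _ => false
  end.

Definition is_count (f : fact) : bool :=
  match f with SentCount _ _ | RecvCount _ _ => true | _ => false end.

Lemma Activated_inj : injective Activated.
Proof. by move=> x y []. Qed.

Lemma cnt_gt0 p mu A : (0 < cnt p mu A) -> exists2 m, m \in mu A & p m.
Proof. by rewrite /cnt -has_count => /hasP[m]; exists m. Qed.

Lemma count_msetD1 (p : pred message) m (M : {mset message}%mset) :
  count p (m +` M)%mset = p m + count p M.
Proof.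
have := perm_eq_seq_mset (m :: M); rewrite mset_cons seq_mset_id.
by move/permP/(_ p) => /=.
Qed.

Lemma in_IncSent f x Phi : ~~ is_sent x f -> (f \in IncSent x Phi) = (f \in Phi).
Proof.
move=> fN; rewrite /IncSent; case: ifP => _; last first.
  by rewrite in_fset1U; case: eqP fN => // -> /=; rewrite eqxx.
apply/imfsetP/idP => /= [[g gP fE]|fP].
  by rewrite fE in fN *; case: g gP fN {fE} => //= y n gP /negbTE->.
by exists f => //; case: f fN fP => //= y n /negbTE->.
Qed.

Lemma in_IncRecv f x Phi : ~~ is_recv x f -> (f \in IncRecv x Phi) = (f \in Phi).
Proof.
move=> fN; rewrite /IncRecv; case: ifP => _; last first.
  by rewrite in_fset1U; case: eqP fN => // -> /=; rewrite eqxx.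
apply/imfsetP/idP => /= [[g gP fE]|fP].
  by rewrite fE in fN *; case: g gP fN {fE} => //= y n gP /negbTE->.
by exists f => //; case: f fN fP => //= y n /negbTE->.
Qed.

(** * Effect of one event on facts and messages *)

(* Count facts are left out of [learns] and [forgets]; see [counts]. *)
Definition learns (e : event) : seq (addr * fact) :=
  match e with
  | EvSpawn x y A B =>
      [:: (A, Activated (Refob x A B)); (B, Created (Refob x A B));
          (B, Created (Refob y B B)); (B, Activated (Refob y B B))]
  | EvSend x ys zs A B Cs =>
      [seq (A, CreatedUsing p.1 p.2) | p <- zip (refobs ys A Cs) (refobs zs B Cs)]
  | EvReceive x B R => [seq (B, Activated z) | z <- R]
  | EvInfo y z B C => [:: (C, Created z)]
  | EvRelease x A B => [:: (B, Released (Refob x A B))]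
  | _ => [::]
  end.

Definition forgets (e : event) : seq (addr * fact) :=
  match e with
  | EvSendInfo y z A B C =>
      [:: (A, CreatedUsing (Refob y A C) (Refob z B C))]
  | EvSendRelease x A B => [:: (A, Activated (Refob x A B))]
  | EvCompaction x B C =>
      [:: (C, Created (Refob x B C)); (C, Released (Refob x B C))]
  | _ => [::]
  end.

(* [n] is the count carried by a release message, which events do not record. *)
Definition posts (n : nat) (e : event) : seq (addr * message) :=
  match e with
  | EvSend x ys zs A B Cs =>
      [:: (B, MApp (Refob x A B) [fset z in refobs zs B Cs])]
  | EvSendInfo y z A B C => [:: (C, MInfo (Refob y A C) (Refob z B C) B)]
  | EvSendRelease x A B => [:: (B, MRelease (Refob x A B) n)]
  | EvIn x A R => [:: (A, MApp x R)]
  | _ => [::]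
  end.

Definition takes (n : nat) (e : event) : seq (addr * message) :=
  match e with
  | EvReceive x B R | EvOut x B R => [:: (B, MApp x R)]
  | EvInfo y z B C | EvInfoOut y z B C => [:: (C, MInfo y z B)]
  | EvRelease x A B => [:: (B, MRelease (Refob x A B) n)]
  | EvReleaseOut x B => [:: (B, MRelease x n)]
  | _ => [::]
  end.

Definition cntat (p : pred message) (A : addr) (s : seq (addr * message)) :=
  count (fun am => (am.1 == A) && p am.2) s.

Lemma know_set (al : {fmap addr -> actor_state}) A s B :
  know al.[A <- s]%fmap B = if B == A then facts_of s else know al B.
Proof. by rewrite /know fnd_set; case: eqP. Qed.

Lemma know_fnd (al : {fmap addr -> actor_state}) A s :
  al.[? A]%fmap = Some s -> know al A = facts_of s.
Proof. by rewrite /know => ->. Qed.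

Lemma know_dom al A : A \notin domf al -> know al A = fset0.
Proof. by rewrite /know => /not_fnd ->. Qed.

Lemma mem_pair_map (I : eqType) (T : eqType) (A B : addr) (F : I -> T) f s :
  ((A, f) \in [seq (B, F p) | p <- s]) = (A == B) && (f \in [seq F p | p <- s]).
Proof.
apply/mapP/andP => [[p ps [-> ->]]|[/eqP-> /mapP[p ps ->]]].
  by rewrite eqxx map_f.
by exists p.
Qed.

(** The hypothesis [h k] lets freshness, which speaks of the history, apply to the current
    configuration: a spawned actor is then new and starts with no facts. *)
Lemma step_know h k e k' f A : h k -> step h k e k' -> ~~ is_count f ->
  (f \in know (actors k') A) =
  ((A, f) \in learns e) ||
  (f \in know (actors k) A) && ((A, f) \notin forgets e).
Proof.
move=> hk st fN; have fS x : ~~ is_sent x f by case: f fN.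
have fR x : ~~ is_recv x f by case: f fN {fS}.
case: st hk => {k e k'} /=;
  try by [move=> *; rewrite andbT].
- move=> al mu rho chi x y B C Phi alB fx fy _ fC hk.
  have Cal : C \notin domf al by apply/negP => Cal; apply: (fC _ hk); apply: Or31.
  have CB : C != B by apply: contraNneq Cal => ->; rewrite -fndSome alB.
  rewrite !know_set; case: (eqVneq A C) => [->|AC].
    rewrite (know_dom Cal) in_fset0 orbF.
    move: (Activated _) (Created _) (Created _) (Activated _) => f1 f2 f3 f4.
    rewrite !in_cons in_nil !in_fsetU !in_fset1 !xpair_eqE.
    by rewrite !eqxx (negPf CB) /= orbF -orbA.
  case: (eqVneq A B) => [->|AB]; rewrite !(inE, in_fsetE) !xpair_eqE.
    by rewrite (know_fnd alB) eqxx [B == C]eq_sym (negPf CB) /= !orbF andbT.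
  by rewrite (negPf AB) (negPf AC) /= andbT.
- move=> al mu rho chi x ys zs B C Cs Phi alB *.
  rewrite know_set mem_pair_map andbT; case: eqP => [->|//] /=.
  rewrite !(inE, in_fsetE) in_IncSent // (know_fnd alB) orbC.
  by [].
- move=> al mu rho chi x B R Phi alB *.
  rewrite know_set mem_pair_map andbT; case: eqP => [->|//] /=.
  rewrite !(inE, in_fsetE) in_IncRecv // (know_fnd alB) orbC; congr (_ || _).
  by apply/imfsetP/mapP => -[z zR ->]; exists z.
- move=> al mu rho chi B Phi alB *.
  by rewrite know_set andbT; case: eqP => [->|//]; rewrite (know_fnd alB).
- move=> al mu rho chi y z B C D Phi alB *.
  rewrite know_set inE xpair_eqE negb_and; case: eqP => [->|] /=; last by rewrite andbT.
  by rewrite in_IncSent // (know_fnd alB) !(inE, in_fsetE) andbC.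
- move=> al mu rho chi y z B C Phi alB *.
  rewrite know_set inE xpair_eqE andbT; case: eqP => [->|//] /=.
  by rewrite in_fset1U in_IncRecv // (know_fnd alB).
- move=> al mu rho chi x B C n Phi alB *.
  rewrite know_set inE xpair_eqE negb_and; case: eqP => [->|] /=; last by rewrite andbT.
  rewrite !(inE, in_fsetE) (know_fnd alB).
  have -> : f != SentCount (Refob x B C) n by apply: contraNneq fN => ->.
  by rewrite andTb andbC.
- move=> al mu rho chi x B C n Phi alB *.
  rewrite know_set inE xpair_eqE andbT; case: eqP => [->|//] /=.
  by rewrite in_fset1U (know_fnd alB).
- move=> al mu rho chi x B C Phi alB *.
  rewrite know_set !inE !xpair_eqE negb_or.
  case: eqP => [->|] /=; last by rewrite andbT.
  rewrite !(inE, in_fsetE) (know_fnd alB).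
  by rewrite fR andbT andbC andbA [X in X && _]andbC.
Qed.

Lemma cnt_post p mu B m A :
  cnt p (post mu B m) A = ((B == A) && p m) + cnt p mu A.
Proof.
rewrite /cnt /post [B == A]eq_sym; case: eqP => //= ->; exact: count_msetD1.
Qed.

Lemma cnt_take p mu B m A : m \in mu B ->
  cnt p mu A = ((B == A) && p m) + cnt p (take_msg mu B m) A.
Proof.
rewrite /cnt /take_msg [B == A]eq_sym; case: eqP => //= -> mB.
by rewrite -count_msetD1 msetB1K.
Qed.

(** A balance of sums avoids truncated subtraction and suits [lia]. The same [n], the count carried
    by a release message, serves all [p] and [A]. *)
Lemma step_cnt h k e k' : step h k e k' -> exists n, forall p A,
  cnt p (undelivered k') A + cntat p A (takes n e) =
  cnt p (undelivered k) A + cntat p A (posts n e).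
Proof.
case=> {k e k'} /=; intros;
  try (exists 0; by []);
  try (exists 0 => ? ?; by rewrite /cntat /= cnt_post !addn0 addnC);
  try (exists n => ? ?; by rewrite /cntat /= cnt_post !addn0 addnC);
  match goal with H : is_true (?m \in ?mu ?B) |- _ =>
    (exists n || exists 0) => ? ?;
    by rewrite /cntat /= (cnt_take _ _ H) !addn0 addnC
  end.
Qed.

(** * Consequences of freshness *)

Definition absent (r : refob) (k : config) : Prop :=
  (forall A f, r \in refobs_of_fact f -> f \notin know (actors k) A) /\
  (forall (p : pred message) A, (forall m, p m -> r \in refobs_of_message m) ->
     cnt p (undelivered k) A = 0).

Lemma occurs_know r k A f :
  f \in know (actors k) A -> r \in refobs_of_fact f -> occurs r k.
Proof.
rewrite /know; case E: (actors k).[? A]%fmap => [s|//] fA rf.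
by left; exists A, s, f.
Qed.

Lemma fresh_absent (h : history) k r :
  h k -> fresh_token h (tok r) -> absent r k.
Proof.
move=> hk fr; split=> [A f rf|p A pr].
  by apply/negP => fA; apply: (fr _ hk); exists r; split=> //; apply: occurs_know fA rf.
apply/eqP; rewrite -leqn0 leqNgt; apply/negP => /cnt_gt0[m mA pm].
by apply: (fr _ hk); exists r; split=> //; right; exists A, m; split=> //; apply: pr.
Qed.

Lemma mem_zip (I J : eqType) (x : I) (y : J) s t :
  (x, y) \in zip s t -> x \in s /\ y \in t.
Proof.
elim: s t => [|a s IH] [|b t] //=; rewrite !inE => /orP[/eqP[-> ->]|/IH[-> ->]].
  by rewrite !eqxx.
by rewrite !orbT.
Qed.

Lemma refobs_tok xs A Bs r : r \in refobs xs A Bs -> tok r \in xs.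
Proof. by case/mapP => -[x B] /mem_zip[xs_x _] ->. Qed.

Lemma step_creates_fresh h k e k' r :
  step h k e k' -> r \in creates e -> fresh_token h (tok r).
Proof.
case=> {k e k'} //=.
- by move=> al mu rho chi x y A B Phi _ fx fy _ _; rewrite !inE => /orP[]/eqP->.
- move=> al mu rho chi x ys zs A B Cs Phi _ _ _ _ _ _ fz /refobs_tok; exact: fz.
- by move=> al mu rho chi x A R _ _ _ _ fR /fR[].
Qed.

Lemma step_creates_absent (h : history) k e k' r :
  h k -> step h k e k' -> r \in creates e -> absent r k.
Proof. by move=> hk st /(step_creates_fresh st); apply: fresh_absent. Qed.

(** The guards check presence before removal, so a removed fact can pay for the message that
    [SendInfo] or [SendRelease] posts. *)
Lemma step_forgets h k e k' A f :
  step h k e k' -> (A, f) \in forgets e -> f \in know (actors k) A.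
Proof.
case=> {k e k'} //=.
- by move=> al mu rho chi y z B C D Phi /know_fnd alB fP; rewrite inE => /eqP[-> ->]; rewrite alB.
- by move=> al mu rho chi x B C n Phi /know_fnd alB fP _ _; rewrite inE => /eqP[-> ->]; rewrite alB.
- move=> al mu rho chi x B C Phi /know_fnd alB fP fP'.
  by rewrite !inE => /orP[]/eqP[-> ->]; rewrite alB.
Qed.

(** * The facts about a fixed refob that each event adds or removes *)

(** The address test is implied by equality of refobs; dropping it leaves the single boolean
    [r == Refob x A B] in the arithmetic goals. *)
Lemma eq_refob_owner x A B r : (A == owner r) && (Refob x A B == r) = (r == Refob x A B).
Proof. by rewrite [RHS]eq_sym; apply: andb_idl => /eqP<-. Qed.

Lemma eq_refob_target x A B r : (B == target r) && (Refob x A B == r) = (r == Refob x A B).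
Proof. by rewrite [RHS]eq_sym; apply: andb_idl => /eqP<-. Qed.

Lemma learns_Activated e r :
  ((owner r, Activated r) \in learns e) =
  match e with
  | EvSpawn x y A B => r \in creates e
  | EvReceive x B R => (B == owner r) && (r \in R)
  | _ => false
  end.
Proof.
case: e => //=.
- move=> x y A B; rewrite !inE.
  apply/or4P/orP => [[]/eqP[_]// ->|[]/eqP->].
  + by left.
  + by right.
  + by apply: Or41.
  + by apply: Or44.
- move=> x ys zs A B Cs; rewrite mem_pair_map; apply/andP => -[_ /mapP[] //].
- move=> x B R; rewrite mem_pair_map eq_sym mem_map //; exact: Activated_inj.
- by move=> y z B C; rewrite inE; apply/eqP => -[].
- by move=> y z B; rewrite inE; apply/eqP => -[].
Qed.

Lemma forgets_Activated e r :
  ((owner r, Activated r) \in forgets e) =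
  if e is EvSendRelease x A B then r == Refob x A B else false.
Proof.
case: e => //=.
- by move=> *; rewrite inE; apply/eqP => -[].
- by move=> x A B; rewrite inE; apply/eqP/eqP => [[_ ->]|->].
- by move=> *; rewrite !inE; apply/orP => -[] /eqP[].
Qed.

Lemma learns_Released e r :
  ((target r, Released r) \in learns e) =
  if e is EvRelease x A B then r == Refob x A B else false.
Proof.
case: e => //=.
- by move=> *; rewrite !inE; apply/or4P => -[] /eqP[].
- by move=> *; rewrite mem_pair_map; apply/andP => -[_ /mapP[]].
- by move=> *; rewrite mem_pair_map; apply/andP => -[_ /mapP[]].
- by move=> *; rewrite inE; apply/eqP => -[].
- by move=> x A B; rewrite inE; apply/eqP/eqP => [[_ ->]|->].
Qed.

Lemma forgets_Released e r :
  ((target r, Released r) \in forgets e) =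
  if e is EvCompaction x A B then r == Refob x A B else false.
Proof.
case: e => //=.
- by move=> *; rewrite inE; apply/eqP => -[].
- by move=> *; rewrite inE; apply/eqP => -[].
- by move=> x A B; rewrite !inE; apply/orP/eqP => [[/eqP[]|/eqP[_ ->]] //|->]; right.
Qed.

Lemma learns_Created e r :
  ((target r, Created r) \in learns e) =
  match e with
  | EvSpawn x y A B => r \in creates e
  | EvInfo y z B C => (C == target r) && (z == r)
  | _ => false
  end.
Proof.
case: e => //=.
- move=> x y A B; rewrite !inE.
  apply/or4P/orP => [[]/eqP[_]// ->|[]/eqP->].
  + by left.
  + by right.
  + by apply: Or42.
  + by apply: Or43.
- by move=> *; rewrite mem_pair_map; apply/andP => -[_ /mapP[]].
- by move=> *; rewrite mem_pair_map; apply/andP => -[_ /mapP[]].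
- by move=> y z B C; rewrite inE; apply/eqP/andP => [[-> ->]|[/eqP-> /eqP->]].
- by move=> *; rewrite inE; apply/eqP => -[].
Qed.

Lemma forgets_Created e r :
  ((target r, Created r) \in forgets e) =
  if e is EvCompaction x A B then r == Refob x A B else false.
Proof.
case: e => //=.
- by move=> *; rewrite inE; apply/eqP => -[].
- by move=> *; rewrite inE; apply/eqP => -[].
- by move=> x A B; rewrite !inE; apply/orP/eqP => [[/eqP[_ ->]|/eqP[]] //|->]; left.
Qed.

Lemma learns_CreatedUsing e D y r :
  (D, CreatedUsing y r) \in learns e ->
  if e is EvSend x ys zs A B Cs then
    [/\ D = A, r \in creates e & (y, r) \in zip (refobs ys A Cs) (refobs zs B Cs)]
  else False.
Proof.
case: e => //=.
- by move=> x y' A B; rewrite !inE => /or4P[] /eqP[].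
- move=> x ys zs A B Cs; rewrite mem_pair_map => /andP[/eqP-> /mapP[[p q] pq [-> ->]]].
  by split=> //; case/mem_zip: pq.
- by move=> x B R; rewrite mem_pair_map => /andP[_ /mapP[]].
- by move=> y' z B C; rewrite inE => /eqP[].
- by move=> x A B; rewrite inE => /eqP[].
Qed.

(** * Uniqueness of the right to use a refob *)

(* The right to use [r] passes from an [App] message to an [Activated] fact, a
   [Release] message and a [Released] fact, and is never duplicated. *)
Definition activity (r : refob) (k : config) : nat :=
  cnt (carries r) (undelivered k) (owner r) +
  (Activated r \in know (actors k) (owner r)) +
  cnt (releases r) (undelivered k) (target r) +
  (Released r \in know (actors k) (target r)).

Lemma absent_activity r k : absent r k -> activity r k = 0.
Proof.
case=> Hf Hm; rewrite /activity !Hm ?(negPf (Hf _ _ _)) //= ?mem_head //.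
  by case=> //= x n /eqP->; apply: mem_head.
by case=> //= x R; rewrite inE orbC => ->.
Qed.

(** Every event moves units between the summands or removes them, except a creation of [r], before
    which freshness makes the sum [0]. *)
Lemma step_activity (h : history) k e k' r : h k -> step h k e k' ->
  activity r k <= 1 -> activity r k' <= 1.
Proof.
move=> hk st.
have [n cntE] := step_cnt st.
have abs : r \in creates e -> activity r k = 0.
  by move=> rc; apply: absent_activity; apply: step_creates_absent rc; eassumption.
have fA := step_forgets (A := owner r) (f := Activated r) st.
move: abs fA (cntE (carries r) (owner r)) (cntE (releases r) (target r)).
rewrite /activity !(step_know _ hk st) // forgets_Activated learns_Activated.
rewrite forgets_Released learns_Released /cntat.
move: (cnt _ _ _) (cnt _ _ _) (cnt _ _ _) (cnt _ _ _) => c1 c2 c3 c4.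
move: (_ \in know _ _) (_ \in know _ _) => b1 b2.
case: e {st cntE} => [x y A B|x ys zs A B Cs|x B R|A|y z A B C|y z B C|x A B
  |x A B|x B C|A Phi|x A R|x B R|x B|y z B C] /=;
  rewrite ?eq_refob_owner ?eq_refob_target ?in_fset ?andbF ?andbT ?addn0 //=;
  first [lia | by case: (r \in R); lia].
Qed.

(** * Uniqueness of the evidence of creation *)

(** The [CreatedUsing] stage stays outside the sum, since neither the actor holding the fact nor its
    first refob is determined by [r]. *)
Definition creation (r : refob) (k : config) : nat :=
  cnt (informs r) (undelivered k) (target r) +
  (Created r \in know (actors k) (target r)).

(* The evidence that [r] was created passes from a [CreatedUsing] fact to
   an [Info] message and then to a [Created] fact, and is never duplicated. *)
Record creation_unique (r : refob) (k : config) : Prop := {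
  using_owner : forall A y, CreatedUsing y r \in know (actors k) A -> A = owner y;
  using_inj : forall A B y z, CreatedUsing y r \in know (actors k) A ->
    CreatedUsing z r \in know (actors k) B -> y = z;
  using_excl : forall A y, CreatedUsing y r \in know (actors k) A ->
    creation r k = 0;
  creation_le1 : creation r k <= 1
}.

Lemma absent_creation r k : absent r k -> creation r k = 0.
Proof.
case=> Hf Hm; rewrite /creation Hm ?(negPf (Hf _ _ _)) //= ?mem_head //.
by case=> //= x y A /eqP->; rewrite !inE eqxx orbT.
Qed.

(** The tokens [zs] are distinct, so the token of [r] determines its position in the list. *)
Lemma mem_zip_refobs_inj (I : eqType) (s : seq I) zs B Cs y y' r :
  uniq zs -> (y, r) \in zip s (refobs zs B Cs) ->
  (y', r) \in zip s (refobs zs B Cs) -> y = y'.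
Proof.
rewrite /refobs; elim: s zs Cs => [|a s IH] [|z zs] [|C Cs] //= /andP[zN zs_uniq].
rewrite !inE => /orP[/eqP[-> ->]|yr] /orP[/eqP|y'r].
- by case.
- by case/mem_zip: y'r => _ /refobs_tok/= zI; rewrite zI in zN.
- by case/mem_zip: yr => _ /refobs_tok + [_ rE]; rewrite rE => zI; rewrite zI in zN.
- exact: IH yr y'r.
Qed.

Lemma step_using h k e k' D y r : h k -> step h k e k' ->
  CreatedUsing y r \in know (actors k') D ->
  r \in creates e \/
  CreatedUsing y r \in know (actors k) D /\ (D, CreatedUsing y r) \notin forgets e.
Proof.
move=> hk st; rewrite (step_know _ hk st) // => /orP[|/andP]; last by right.
by move/learns_CreatedUsing; case: e st => //= x ys zs A B Cs st [_ rc _]; left.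
Qed.

(** The last term is the unit that enters the sum from outside: from a spawn, or from the
    [CreatedUsing] fact that [SendInfo] consumes. *)
Lemma step_creation_le (h : history) k e k' r : h k -> step h k e k' ->
  creation r k' <= creation r k +
    match e with
    | EvSpawn _ _ _ _ => r \in creates e
    | EvSendInfo y z A B C => r == Refob z B C
    | _ => false
    end.
Proof.
move=> hk st; have [n cntE] := step_cnt st.
move: (cntE (informs r) (target r)).
rewrite /creation !(step_know _ hk st) // forgets_Created learns_Created /cntat.
case: e {st cntE} => [x y A B|x ys zs A B Cs|x B R|A|y z A B C|y z B C|x A B
  |x A B|x B C|A Phi|x A R|x B R|x B|y z B C] /=;
  rewrite ?eq_refob_owner ?eq_refob_target ?in_fset ?andbF ?andbT ?addn0 //=; lia.
Qed.

Lemma step_creation_unique (h : history) k e k' r : h k -> step h k e k' ->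
  creation_unique r k -> creation_unique r k'.
Proof.
move=> hk st [own inj excl le1].
have le := step_creation_le r hk st.
(* If [r] is created now, it was absent before, and all evidence stems from this event. *)
have [rc|rN] := boolP (r \in creates e).
  have [Hf Hm] := step_creates_absent hk st rc.
  have noCU D y : CreatedUsing y r \in know (actors k) D = false.
    by apply/negbTE/Hf; rewrite !inE eqxx orbT.
  have c0 := absent_creation (conj Hf Hm).
  have CU D y : CreatedUsing y r \in know (actors k') D ->
      (D, CreatedUsing y r) \in learns e.
    by rewrite (step_know _ hk st) // noCU orbF.
  split=> [D y|D D' y z|D y|].
  - move/CU/learns_CreatedUsing; case: e {st CU le} rc => //= x ys zs A B Cs _ [-> _].
    by case/mem_zip => /mapP[p _ ->].
  - move=> /CU/learns_CreatedUsing + /CU/learns_CreatedUsing.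
    case: e {CU le rc} st => //= x ys zs A B Cs st [_ _ +] [_ _].
    apply: mem_zip_refobs_inj.
    by inversion st.
  - move/CU/learns_CreatedUsing; case: e {st CU} le rc => //= x ys zs A B Cs le _ _.
    by move: le; rewrite c0 leqn0 => /eqP.
  - by move: le; rewrite c0 add0n; case: e {st CU} rc => //= *; lia.
have old D y : CreatedUsing y r \in know (actors k') D ->
    CreatedUsing y r \in know (actors k) D /\ (D, CreatedUsing y r) \notin forgets e.
  by case/(step_using hk st) => // rc; rewrite rc in rN.
split=> [D y /old[/own] //|D D' y z /old[yD _] /old[zD' _]|D y /old[yD yN]|].
- exact: inj yD zD'.
- have c0 := excl _ _ yD; move: le; rewrite c0 add0n => le.
  apply/eqP; rewrite -leqn0 (leq_trans le) //.
  case: e st rN yN {old le} => //= [x z A B _ /negbTE->|w z A B C st _] //.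
  case: eqP => // rE; subst r.
  (* If this event sends the info about [r], the fact it removes is, by uniqueness, the one assumed
     to remain: a contradiction. *)
  have := step_forgets (A := A) (f := CreatedUsing (Refob w A C) (Refob z B C)) st.
  rewrite /= mem_head => /(_ isT) wA.
  by rewrite (own _ _ yD) (inj _ _ _ _ yD wA) mem_head.
- apply: (leq_trans le); case: e st rN {old le} => //=; rewrite ?addn0 //.
    by move=> x z A B _ /negbTE->; rewrite addn0.
  move=> w z A B C st _; case: eqP => [rE|_]; last by rewrite addn0.
  (* The consumed [CreatedUsing] fact forces the old sum to be [0], so the added unit brings it to
     at most [1]. *)
  subst r; rewrite (excl A (Refob w A C)) //.
  by apply: (step_forgets st); rewrite mem_head.
Qed.

Definition traced (r : refob) (k : config) : Prop :=
  (exists A y, CreatedUsing y r \in know (actors k) A) \/ 0 < creation r k.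

(** Evidence that is gone can come back only through a creation, which the freshness of tokens
    excludes for a released refob. *)
Lemma step_traced (h : history) k e k' r : h k -> step h k e k' ->
  traced r k' -> traced r k \/ r \in creates e.
Proof.
move=> hk st; have le := step_creation_le r hk st.
have [rc|/negbTE rN] := boolP (r \in creates e); first by right.
case=> [[A [y yA']]|c_gt0]; left.
  by case/(step_using hk st): yA' => [|[yA _]]; [rewrite rN|left; exists A, y].
have [c0|c_gt] := posnP (creation r k); last by right.
have := leq_trans c_gt0 le; rewrite c0 add0n.
case: e {le} st rN => //= [x y A B _ -> //|y z A B C st _].
case: eqP => // -> _.
left; exists A, (Refob y A C); apply: (step_forgets st); exact: mem_head.
Qed.

(** The [Created] fact at [C] is already the only unit of evidence, so neither an [Info] message nor
    a [CreatedUsing] fact survives its removal. *)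
Lemma compaction_untraced (h : history) k k' x B C : h k ->
  step h k (EvCompaction x B C) k' -> creation_unique (Refob x B C) k ->
  ~ traced (Refob x B C) k'.
Proof.
move=> hk st uq; have crC : Created (Refob x B C) \in know (actors k) C.
  by apply: (step_forgets st); rewrite mem_head.
have := creation_le1 uq; rewrite /creation /= crC => le.
have [n cntE] := step_cnt st.
have := cntE (informs (Refob x B C)) C; rewrite /cntat /= => cE.
case=> [[A [y]]|].
  case/(step_using hk st) => [//|[yA _]].
  by have := using_excl uq yA; rewrite /creation /= crC addn1.
rewrite /creation (step_know _ hk st) // forgets_Created learns_Created /=.
rewrite eqxx andbF; lia.
Qed.

(** * Internal and external actors *)

Lemma step_dom h k e k' A : step h k e k' ->
  A \in domf (actors k') -> A \in domf (actors k) \/ fresh_addr h A.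
Proof.
have sub (al : {fmap addr -> actor_state}) B s : al.[? B]%fmap = Some s ->
    A \in B |` domf al -> A \in domf al.
  by move=> alB; rewrite in_fset1U => /orP[/eqP->|//]; rewrite -fndSome alB.
case=> {k e k'} /=; try by [left];
  try by [move=> *; left; eapply sub; eassumption].
move=> al mu rho chi x y B C Phi alB _ _ _ fC.
rewrite in_fset1U => /orP[/eqP->|]; [by right|left].
exact: sub alB _.
Qed.

Lemma step_externals h k e k' A : step h k e k' ->
  A \in externals k' -> A \in externals k \/ A \notin domf (actors k').
Proof.
case=> {k e k'} /=; try by [left].
move=> al mu rho chi x B R _ _ _ _ _; rewrite in_fsetU => /orP[]; first by left.
by rewrite !in_fsetE /= => /andP[_]; right.
Qed.

Lemma step_externals_sub h k e k' A : step h k e k' ->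
  A \in externals k -> A \in externals k'.
Proof.
case=> {k e k'} //= al mu rho chi x B R _ _ _ _ _.
by rewrite in_fsetU => ->.
Qed.

Definition internal_external_disjoint (k : config) : Prop :=
  forall A, A \in domf (actors k) -> A \notin externals k.

(** Only targets outside the domain become external, and a spawned address is fresh, hence not
    external. *)
Lemma step_disjoint (h : history) k e k' : h k -> step h k e k' ->
  internal_external_disjoint k -> internal_external_disjoint k'.
Proof.
move=> hk st disj A domA; apply/negP => /(step_externals st)[extA|]; last by rewrite domA.
case: (step_dom st domA) => [/disj|/(_ _ hk)]; first by rewrite extA.
by apply; apply: Or32.
Qed.

(** * Persistence of the right to use a refob *)

Definition pending (r : refob) (k : config) : nat :=
  cnt (carries r) (undelivered k) (owner r) +
  (Activated r \in know (actors k) (owner r)).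

(** Only [Release], [Out] and [ReleaseOut] take units out of this sum; the last two act at an
    external address, which gives the last two disjuncts. *)
Lemma step_live (h : history) k e k' r : h k -> step h k e k' ->
  0 < pending r k + cnt (releases r) (undelivered k) (target r) ->
  [\/ 0 < pending r k' + cnt (releases r) (undelivered k') (target r),
      e = EvRelease (tok r) (owner r) (target r),
      owner r \in externals k
    | target r \in externals k].
Proof.
move=> hk st.
have [n cntE] := step_cnt st.
move: (cntE (carries r) (owner r)) (cntE (releases r) (target r)).
rewrite /pending (step_know _ hk st) // forgets_Activated learns_Activated /cntat.
case: e st {cntE} => [x y A B|x ys zs A B Cs|x B R|A|y z A B C|y z B C|x A B
  |x A B|x B C|A Phi|x A R|x B R|x B|y z B C] st /=;
  rewrite ?eq_refob_owner ?eq_refob_target ?andbF ?andbT ?addn0 //=;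
  try by [move=> *; apply: Or41; lia].
- have [->|_] := eqVneq r (Refob x A B); first by move=> *; apply: Or42.
  by move=> *; apply: Or41; lia.
- have [BE|_] := eqVneq B (owner r); last by move=> *; apply: Or41; lia.
  by move=> *; apply: Or43; rewrite -BE; inversion st.
- have [BE|_] := eqVneq B (target r); last by move=> *; apply: Or41; lia.
  by move=> *; apply: Or44; rewrite -BE; inversion st.
Qed.

Lemma step_inP h k x A R k' : step h k (EvIn x A R) k' ->
  owner x \notin domf (actors k) /\
  forall r, r \in R -> owner r = A /\ tok r != tok x.
Proof.
move eE: (EvIn x A R) => e st; case: st eE => //=.
move=> al mu rho chi y B R' _ _ yN _ fR [-> -> ->]; by split=> // r /fR[].
Qed.

Lemma step_creates_pending (h : history) k e k' r : h k -> step h k e k' ->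
  r \in creates e -> 0 < pending r k'.
Proof.
move=> hk st.
have [n cntE] := step_cnt st.
move: (cntE (carries r) (owner r)).
rewrite /pending (step_know _ hk st) // forgets_Activated learns_Activated /cntat.
case: e st {cntE} => [x y A B|x ys zs A B Cs|x B R|A|y z A B C|y z B C|x A B
  |x A B|x B C|A Phi|x A R|x B R|x B|y z B C] //= st.
- by move=> _ ->; rewrite addn1.
- move=> + rz; rewrite in_fset rz andbT.
  have -> : B == owner r by case/mapP: rz => p _ ->.
  by move=> E; lia.
- move=> + rR; rewrite rR andbT.
  have -> : A == owner r by have [_ /(_ _ rR)[->]] := step_inP st.
  by move=> E; lia.
Qed.

Lemma step_pending (h : history) k e k' r : h k -> step h k e k' ->
  0 < pending r k' -> 0 < pending r k \/ r \in creates e.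
Proof.
move=> hk st.
have [n cntE] := step_cnt st.
move: (cntE (carries r) (owner r)).
rewrite /pending (step_know _ hk st) // forgets_Activated learns_Activated /cntat.
have [rc|/negbTE rN] := boolP (r \in creates e); first by right.
case: e rN st {cntE} => [x y A B|x ys zs A B Cs|x B R|A|y z A B C|y z B C|x A B
  |x A B|x B C|A Phi|x A R|x B R|x B|y z B C] /= rN st;
  rewrite ?in_fset ?rN ?andbF ?andbT ?addn0 => *; left; lia.
Qed.

(** * Balance of send and receive counts *)

Definition in_flight (r : refob) (k : config) : nat :=
  cnt (sent_along r) (undelivered k) (target r).

(** The boolean lets one set of lemmas serve both send counts ([true]) and receive counts
    ([false]). *)
Definition count_fact (b : bool) : refob -> nat -> fact :=
  if b then SentCount else RecvCount.
Definition inc_count (b : bool) : refob -> knowledge -> knowledge :=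
  if b then IncSent else IncRecv.

Definition counts (b : bool) (e : event) (A : addr) (r : refob) : bool :=
  match e with
  | EvSend x _ _ B C _ => (B == A) && ((true == b) && (Refob x B C == r))
  | EvSendInfo y _ B _ C => (B == A) && ((true == b) && (Refob y B C == r))
  | EvReceive x B _ => (B == A) && ((false == b) && (x == r))
  | EvInfo y _ _ C => (C == A) && ((false == b) && (y == r))
  | _ => false
  end.

Lemma derives_countP b Phi r n : derives Phi (count_fact b r n) <->
  count_fact b r n \in Phi \/
  n = 0 /\ forall m, count_fact b r m \notin Phi.
Proof.
split=> [|[|[->]]]; [|exact: derives_ax|by case: b => ?; constructor].
by case: b => H; inversion H; subst; [left|right|left|right].
Qed.

Lemma derives_count_ext b Phi Psi r n :
  (forall m, (count_fact b r m \in Psi) = (count_fact b r m \in Phi)) ->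
  derives Phi (count_fact b r n) -> derives Psi (count_fact b r n).
Proof.
move=> E /derives_countP H; apply/derives_countP; rewrite E.
by case: H => [|[-> H]]; [left|right; split=> // m; rewrite E].
Qed.

(** Using derivable instead of stored counts covers the first increment: the default value is [0],
    and the increment then stores [1]. *)
Lemma derives_inc b c x Phi r n : derives Phi (count_fact b r n) ->
  derives (inc_count c x Phi) (count_fact b r (n + ((c == b) && (x == r)))).
Proof.
have [-> /=|cb] := eqVneq c b; last first.
  rewrite addn0; apply: derives_count_ext => m.
  by case: b c cb => -[] //= _; [apply: in_IncRecv|apply: in_IncSent].
have [->|xr] := eqVneq x r; last first.
  rewrite addn0; apply: derives_count_ext => m.
  by case: b => /=; [apply: in_IncSent|apply: in_IncRecv]; rewrite /= eq_sym.
rewrite addn1 => /derives_countP[rP|[-> rN]].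
  apply: derives_ax; case: b rP => rP; rewrite /= /IncSent /IncRecv ifT.
  + by apply/imfsetP; exists (SentCount r n) => //=; rewrite eqxx.
  + by apply/hasP; exists (SentCount r n) => //=.
  + by apply/imfsetP; exists (RecvCount r n) => //=; rewrite eqxx.
  + by apply/hasP; exists (RecvCount r n) => //=.
apply: derives_ax; case: b rN => rN; rewrite /= /IncSent /IncRecv ifF ?in_fset1U ?eqxx //.
all: apply/negbTE/hasPn => f; apply: contraL; case: f => //= y m /eqP->; exact: rN.
Qed.

Lemma count_fact_neq b r n f : ~~ is_count f -> (count_fact b r n == f) = false.
Proof. by move=> fN; apply/eqP => fE; rewrite -fE in fN; case: b fN {fE}. Qed.

(** Only the two excluded events delete counts of [r]; every other event keeps or increments
    them. *)
Lemma step_count (h : history) k e k' b A r n : h k -> step h k e k' ->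
  e <> EvSendRelease (tok r) (owner r) (target r) ->
  e <> EvCompaction (tok r) (owner r) (target r) ->
  derives (know (actors k) A) (count_fact b r n) ->
  derives (know (actors k') A) (count_fact b r (n + counts b e A r)).
Proof.
move=> hk st neS neC; case: st hk neS neC => {k e k'} /=;
  try by [move=> *; rewrite addn0].
- move=> al mu rho chi x y B C Phi alB fx fy _ fC hk _ _.
  (* The new actor has no counts, like the empty set that [know] assigned to its address before, so
     the default [0] persists. *)
  have Cal : C \notin domf al by apply/negP => Cal; apply: (fC _ hk); apply: Or31.
  rewrite !know_set addn0; case: eqVneq => [->|_].
    rewrite (know_dom Cal); apply: derives_count_ext => m.
    by rewrite in_fset0 !in_fsetU !in_fset1 !count_fact_neq.
  case: eqVneq => [->|//]; rewrite (know_fnd alB); apply: derives_count_ext => m.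
  by rewrite in_fset1U count_fact_neq.
- move=> al mu rho chi x ys zs B C Cs Phi alB _ _ _ _ _ _ _ _ _.
  rewrite know_set [B == A]eq_sym.
  case: eqVneq => [->|_]; last by rewrite addn0.
  rewrite (know_fnd alB) => /(derives_inc true (Refob x B C)).
  apply: derives_count_ext => m; rewrite in_fsetU in_fset orb_idr //.
  by move=> /mapP[p _ /eqP]; rewrite count_fact_neq.
- move=> al mu rho chi x B R Phi alB _ _ _ _.
  rewrite know_set [B == A]eq_sym.
  case: eqVneq => [->|_]; last by rewrite addn0.
  rewrite (know_fnd alB) => /(derives_inc false x).
  apply: derives_count_ext => m; rewrite in_fsetU orb_idr //.
  by move=> /imfsetP[p _ /eqP]; rewrite count_fact_neq.

- move=> al mu rho chi B Phi alB _ _ _; rewrite know_set addn0.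
  by case: eqVneq => [->|//]; rewrite (know_fnd alB).
- move=> al mu rho chi y z B C D Phi alB _ _ _ _.
  rewrite know_set [B == A]eq_sym.
  case: eqVneq => [->|_]; last by rewrite addn0.
  rewrite (know_fnd alB) => dP; apply: (derives_inc true).
  by apply: derives_count_ext dP => m; rewrite in_fsetD1 count_fact_neq.

- move=> al mu rho chi y z B C Phi alB _ _ _ _.
  rewrite know_set [C == A]eq_sym.
  case: eqVneq => [->|_]; last by rewrite addn0.
  rewrite (know_fnd alB) => /(derives_inc false y).
  by apply: derives_count_ext => m; rewrite in_fset1U count_fact_neq.

- move=> al mu rho chi x B C m Phi alB xP cP _ _ ne _; rewrite know_set addn0.
  case: eqVneq => [->|//]; rewrite (know_fnd alB).
  apply: derives_count_ext => p; rewrite !in_fsetD1 [X in _ && (~~ X && _)]count_fact_neq //=.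
  apply/andb_idl => _; apply/eqP; case: b => // -[rE _]; apply: ne.
  by rewrite rE.
- move=> al mu rho chi x B C m Phi alB _ _ _ _ _; rewrite know_set addn0.
  case: eqVneq => [->|//]; rewrite (know_fnd alB).
  by apply: derives_count_ext => p; rewrite in_fset1U count_fact_neq.
- move=> al mu rho chi x B C Phi alB _ _ _ _ ne; rewrite know_set addn0.
  case: eqVneq => [->|//]; rewrite (know_fnd alB).
  apply: derives_count_ext => p; rewrite in_fset inE !in_fsetD1 !count_fact_neq // andTb andbC.
  apply/andb_idl => _; case: b => //=; apply/eqP => rE; apply: ne.
  by rewrite rE.
Qed.

(** Messages along [r] are posted by counted sends and consumed by counted receives, except in [In],
    [Out] and [InfoOut], which the two hypotheses rule out for [r]. *)
Lemma step_in_flight h k e k' r : step h k e k' ->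
  owner r \in domf (actors k) \/ r \in creates e ->
  target r \notin externals k ->
  in_flight r k' + counts false e (target r) r =
  in_flight r k + counts true e (owner r) r.
Proof.
move=> st own ext; have [n cntE] := step_cnt st.
move: (cntE (sent_along r) (target r)); rewrite /in_flight /cntat.
case: e st own {cntE} => [x y A B|x ys zs A B Cs|x B R|A|y z A B C|y z B C|x A B
  |x A B|x B C|A Phi|x A R|x B R|x B|y z B C] st own /=;
  rewrite ?eq_refob_owner ?eq_refob_target ?andbF ?addn0 //.
(* The owner of [x] is outside the domain, and refobs created by this event have other tokens than
   [x]; either way [x] is not [r]. *)
- have [xN xR] := step_inP st.
  suff /negbTE-> : x != r by rewrite andbF addn0.
  apply/eqP => rE; subst r; case: own => [|/xR[_]]; first by rewrite (negPf xN).
  by rewrite eqxx.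
- suff /negbTE-> : B != target r by rewrite addn0.
  by apply: contraNneq ext => <-; inversion st.
- suff /negbTE-> : C != target r by rewrite addn0.
  by apply: contraNneq ext => <-; inversion st.
Qed.

Definition balanced (r : refob) (k : config) : Prop := exists n,
  derives (know (actors k) (owner r)) (SentCount r (n + in_flight r k)) /\
  derives (know (actors k) (target r)) (RecvCount r n).

Lemma absent_balanced r k : absent r k -> balanced r k.
Proof.
case=> Hf Hm; exists 0; rewrite /in_flight Hm.
  by split; [apply: derives_sent0|apply: derives_recv0] => n; apply: Hf; rewrite mem_head.
by case=> //= [x R /eqP->|x y A /eqP->]; rewrite mem_head.
Qed.

Lemma pending_occurs r k : 0 < pending r k -> occurs r k.
Proof.
rewrite /pending addn_gt0 => /orP[/cnt_gt0[m mA]|].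
  case: m mA => //= x R mA rR; right; exists (owner r), (MApp x R).
  by split=> //; rewrite inE orbC rR.
case rA: (_ \in _) => // _; apply: occurs_know rA _; exact: mem_head.
Qed.

Lemma step_balanced (h : history) k e k' r : h k -> step h k e k' ->
  activity r k <= 1 ->
  (owner r \in domf (actors k) -> target r \notin externals k ->
   0 < pending r k -> balanced r k) ->
  owner r \in domf (actors k') -> target r \notin externals k' ->
  0 < pending r k' -> balanced r k'.
Proof.
move=> hk st act bal domr extr' pend'.
have extr : target r \notin externals k.
  by apply: contra extr'; apply: step_externals_sub st.
have [own balk] :
    (owner r \in domf (actors k) \/ r \in creates e) /\ balanced r k.
  case: (step_pending hk st pend') => [pend|rc]; last first.
    by split; [right|apply: absent_balanced; apply: step_creates_absent rc; eassumption].
  have domk : owner r \in domf (actors k).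
    (* An owner that only now joins the domain would be fresh, yet its address occurs in the pending
       [r]. *)
    case: (step_dom st domr) => // /(_ _ hk)[]; apply: Or33.
    by exists r; split; [apply: pending_occurs|left].
  by split; [left|apply: bal].
have rE : r == Refob (tok r) (owner r) (target r) by case: (r).
(* Sending the release uses up the only unit of activity, so nothing would stay pending. *)
have neS : e <> EvSendRelease (tok r) (owner r) (target r).
  move=> eE; subst e; have [n cntE] := step_cnt st.
  have := cntE (carries r) (owner r); rewrite /cntat /= andbF !addn0 => cE.
  have fA := step_forgets (A := owner r) (f := Activated r) st.
  rewrite forgets_Activated rE in fA.
  move: pend' act; rewrite /pending /activity cE (step_know _ hk st) //.
  by rewrite learns_Activated forgets_Activated rE fA // andbF; lia.
(* Compaction requires [Released r], which together with a pending right would make the activity at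
   least [2]. *)
have neC : e <> EvCompaction (tok r) (owner r) (target r).
  move=> eE; subst e.
  have fR := step_forgets (A := target r) (f := Released r) st.
  have := pend'; case: (step_pending hk st pend') => // pend _.
  move: pend act; rewrite /pending /activity fR; last first.
    by rewrite forgets_Released rE.
  by lia.
case: balk => n [sent recv].
(* The witness is the new receive count; the balance of messages in flight turns the rest into the
   new send count. *)
exists (n + counts false e (target r) r); split.
  have := step_count hk st neS neC sent (b := true).
  have := step_in_flight st own extr.
  by rewrite -!addnA [counts false _ _ _ + _]addnC => ->.
exact: (step_count hk st neS neC recv (b := false)).
Qed.

(** * The invariant along an execution *)

(** [inv_released] is a disjunction because compaction erases [Released r], but then also the last
    evidence. External addresses are exempted in [inv_live] and [inv_balanced] because messages to
    them are dropped and their counts are not recorded. *)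
Record invariant (E : execution) (t : nat) (r : refob) : Prop := {
  inv_activity : activity r (conf E t) <= 1;
  inv_creation : creation_unique r (conf E t);
  inv_traced : traced r (conf E t) -> created_by E t r;
  inv_released : released_by E t r ->
    Released r \in know (actors (conf E t)) (target r) \/
    ~ traced r (conf E t);
  inv_live : created_by E t r ->
    [\/ 0 < pending r (conf E t) +
            cnt (releases r) (undelivered (conf E t)) (target r),
        released_by E t r,
        owner r \in externals (conf E t)
      | target r \in externals (conf E t)];
  inv_disjoint : internal_external_disjoint (conf E t);
  inv_balanced : owner r \in domf (actors (conf E t)) ->
    target r \notin externals (conf E t) ->
    0 < pending r (conf E t) -> balanced r (conf E t)
}.

Lemma know_initial x y A E B f : f \in know (actors (initial x y A E)) B ->
  B = A /\ [\/ f = Activated (Refob x A E), f = Created (Refob y A A)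
             | f = Activated (Refob y A A)].
Proof.
rewrite know_set; case: eqVneq => [->|_]; last by rewrite /know fnd_fmap0.
rewrite !in_fsetU !in_fset1 -orbA => /or3P fE; split=> //.
by case: fE => /eqP->; [apply: Or31|apply: Or32|apply: Or33].
Qed.

Lemma cnt_initial x y A E p B : cnt p (undelivered (initial x y A E)) B = 0.
Proof. by rewrite /cnt /= enum_mset0. Qed.

Lemma invariant0 E r : invariant E 0 r.
Proof.
have [x [y [A [D [_ AD k0]]]]] := conf_init E.
have noCU B z w : CreatedUsing z w \in know (actors (conf E 0)) B = false.
  by apply/negP; rewrite k0 => /know_initial[_ []].
have noRel B z : Released z \in know (actors (conf E 0)) B = false.
  by apply/negP; rewrite k0 => /know_initial[_ []].
have cnt0 p B : cnt p (undelivered (conf E 0)) B = 0.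
  by rewrite k0 cnt_initial.
have noCount b B m : count_fact b r m \notin know (actors (conf E 0)) B.
  by apply/negP; rewrite k0 => /know_initial[_]; case: b => -[].
split.
- by rewrite /activity !cnt0 noRel; case: (_ \in _).
- split=> [B z|B C z w|B z|]; rewrite ?noCU //.
  by rewrite /creation cnt0; case: (_ \in _).
- case=> [[B [z]]|]; first by rewrite noCU.
  rewrite /creation cnt0; case rC: (_ \in _) => // _.
  by left; apply: occurs_know rC _; apply: mem_head.
- by case=> i; rewrite ltn0.
- case=> [|[i [e []]]]; last by rewrite ltn0.
  rewrite /pending !cnt0 add0n addn0 => occ; apply: Or41; rewrite lt0b.
  have {occ}: [\/ r = Refob x A D | r = Refob y A A].
    rewrite k0 in occ; case: occ => [[B [f [s [sB fs rf]]]]|[B [m []]]]; last first.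
      by rewrite /= in_mset0.
    have := know_initial (x := x) (y := y) (A := A) (E := D) (B := B) (f := s).
    rewrite (know_fnd sB) => /(_ fs)[_ sE]; move: rf.
    case: sE => ->; rewrite inE => /eqP->; by [left|right].
  rewrite k0 => -[] ->; rewrite know_set eqxx !in_fsetU !in_fset1 eqxx ?orbT //.
- move=> B; rewrite k0 /= in_fset1U in_fset0 orbF => /eqP->.
  by rewrite in_fset1.
- move=> _ _ _; exists 0; rewrite /in_flight cnt0.
  by split; [apply: (derives_sent0)|apply: derives_recv0] => n;
    [apply: (noCount true)|apply: (noCount false)].
Qed.

Lemma created_byS E t r : created_by E t.+1 r ->
  created_by E t r \/ exists2 e, ev E t = Some e & r \in creates e.
Proof.
case=> [occ|[i [e [it eE re]]]]; first by left; left.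
move: it; rewrite ltnS leq_eqVlt => /orP[/eqP it|it].
  by right; exists e => //; rewrite -it.
by left; right; exists i, e.
Qed.

Lemma created_by_mono E t r : created_by E t r -> created_by E t.+1 r.
Proof. by case=> [|[i [e [it eE re]]]]; [left|right; exists i, e; split=> //; apply: leqW]. Qed.

Lemma released_byS E t r : released_by E t.+1 r ->
  released_by E t r \/ ev E t = Some (EvRelease (tok r) (owner r) (target r)).
Proof.
case=> i; rewrite ltnS leq_eqVlt => /orP[/eqP->|it] eE; first by right.
by left; exists i.
Qed.

Lemma released_by_mono E t r : released_by E t r -> released_by E t.+1 r.
Proof. by case=> i it eE; exists i => //; apply: leqW. Qed.

(** Just after the release, at [i.+1 <= t], the target holds [Released r], so the token occurs in
    the past. Hence a released refob is never created again. *)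
Lemma released_by_not_fresh E t r :
  released_by E t r -> ~ fresh_token (past E t) (tok r).
Proof.
case=> i it eE; have := conf_step E i; rewrite eE => st fr.
apply: (fr (conf E i.+1)); first by exists i.+1.
exists r; split=> //; apply: (@occurs_know _ _ (target r) (Released r)).
  rewrite (step_know _ _ st) ?learns_Released //; last by exists i.
  by case: (r) => a b c; rewrite eqxx.
exact: mem_head.
Qed.

Lemma invariantS E t r : invariant E t r -> invariant E t.+1 r.
Proof.
move=> [act uq tr rel live disj bal].
have := conf_step E t; case eE: (ev E t) => [e|]; last first.
  (* In the padding of a finite execution nothing changes. *)
  move=> [_ kE].
  have cr : created_by E t.+1 r -> created_by E t r.
    by case/created_byS => // -[e]; rewrite eE.
  have rl : released_by E t.+1 r -> released_by E t r.
    by case/released_byS => //; rewrite eE.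
  split; rewrite kE //.
  - by move/tr/created_by_mono.
  - by move/rl/rel.
  - case/cr/live => [?|?|?|?]; [exact: Or41| |exact: Or43|exact: Or44].
    by apply: Or42; apply: released_by_mono.
rewrite -/(past E t) => st.
have hk : past E t (conf E t) by exists t.
have creating : r \in creates e -> created_by E t.+1 r.
  by move=> re; right; exists t, e.
split.
- exact: step_activity hk st act.
- exact: step_creation_unique hk st uq.
- by case/(step_traced hk st) => [/tr/created_by_mono|/creating].
- case/released_byS => [rl|]; last first.
    rewrite eE => -[eR]; left; rewrite (step_know _ hk st) // learns_Released eR.
    by case: (r) => a b c; rewrite eqxx.
  have ncr : r \notin creates e.
    by apply/negP => /(step_creates_fresh st)/(released_by_not_fresh rl).
  case: (rel rl) => [rR|ntr]; last first.
    by right=> /(step_traced hk st)[//|rc]; rewrite rc in ncr.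
  rewrite (step_know _ hk st) // rR forgets_Released.
  case: e {eE ncr creating} st => /=; try by move=> *; left; rewrite ?orbT.
  move=> x B C st.
  (* Compaction of [r] itself erases [Released r], and with it the last evidence of creation. *)
  case: eqP => [rE|_]; last by left; rewrite ?orbT.
  by right; subst r; apply: compaction_untraced st uq.
- case/created_byS => [/live|[e']]; last first.
    rewrite eE => -[<-] re; apply: Or41.
    by rewrite addn_gt0 (step_creates_pending hk st re).
  case=> [/(step_live hk st)[?|eR|ex|ex]|/released_by_mono|ex|ex].
  - exact: Or41.
  - by apply: Or42; exists t; rewrite // eE eR.
  - by apply: Or43; apply: step_externals_sub st ex.
  - by apply: Or44; apply: step_externals_sub st ex.
  - exact: Or42.
  - by apply: Or43; apply: step_externals_sub st ex.
  - by apply: Or44; apply: step_externals_sub st ex.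
- exact: step_disjoint hk st disj.
- exact: step_balanced hk st act bal.
Qed.

Lemma execution_invariant E t r : invariant E t r.
Proof. by elim: t => [|t]; [apply: invariant0|apply: invariantS]. Qed.

(** * From the invariant to finalized snapshots *)

Lemma derives_CreatedUsing Phi y z :
  derives Phi (CreatedUsing y z) <-> CreatedUsing y z \in Phi.
Proof. by split=> [H|]; [inversion H|apply: derives_ax]. Qed.

Lemma derives_Created Phi r : derives Phi (Created r) ->
  Created r \in Phi \/ exists y, CreatedUsing y r \in Phi.
Proof.
move fE: (Created r) => f fP; case: fP fE => {f} //= [f + fE|y z + [->]].
  by rewrite -fE; left.
by move/derives_CreatedUsing; right; exists y.
Qed.

(** The empty run is among the runs that termination quantifies over. *)
Lemma terminated_no_messages E t A :
  terminated_at E t A -> undelivered (conf E t) A = mset0.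
Proof.
case=> _ noMsg; apply/eqP/negPn/negP => mN; apply: noMsg.
by exists [::], (conf E t); split=> //; apply: run_nil.
Qed.

Theorem theorem6p7 (E : execution) (t : nat) (S : {fset addr}) (Q : snapshots)
    (S_closed : closed_at E t S)
    (S_terminated : forall A, A \in S -> terminated_at E t A)
    (Q_recorded : recorded_in E Q)
    (Q_dom : domf Q = S)
    (Q_consistent : consistent_at E t Q) :
  finalized Q.
Proof.
(* Consistency replaces each snapshot by the knowledge of its actor at time [t]. *)
have QE f : holder f \in S ->
    Qderives Q f <-> derives (know (actors (conf E t)) (holder f)) f.
  rewrite -Q_dom -fndSome /Qderives; case QA: (Q.[? holder f])%fmap => [Phi|//] _.
  have [s /know_fnd-> sE] := Q_consistent _ _ QA.
  by rewrite -sE; split=> [[_ [<-]]|PhiP] //; exists Phi.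
have Qdom f : Qderives Q f -> holder f \in S.
  by case=> Phi QA _; rewrite -Q_dom -fndSome QA.
(* After a release, either [Released r] would still be visible in [Q], or no evidence of [r] would
   be left. *)
have traced_owner r : target r \in S -> traced r (conf E t) ->
    ~ Qderives Q (Released r) -> unreleased E t r.
  move=> rS tr nrel; have inv := execution_invariant E t r.
  split; first exact: inv_traced inv tr.
  case/(inv_released inv) => // rR; apply: nrel.
  by apply/QE => //; apply: derives_ax.
move=> x xQ [n [r [rT [r0C r0N] rCU rn]]].
have xS : target x \in S by rewrite -Q_dom.
have tr i : i <= n -> traced (r i) (conf E t) /\ ~ Qderives Q (Released (r i)).
  case: i => [_|i iN]; last first.
    have [/[dup] /Qdom yS /(QE _ yS)/derives_CreatedUsing yP nrel] := rCU _ iN.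
    by split=> //; left; exists (owner (r i)), (r i).
  have r0S : holder (Created (r 0)) \in S by rewrite /= rT.
  split=> //; have /derives_Created := (QE _ r0S).1 r0C.
  (* [Created (r 0)] may be derived from a [CreatedUsing] fact instead of being stored; both count
     as evidence. *)
  case=> /= [rC|[y yP]]; last by left; exists (target (r 0)), y.
  by right; rewrite /creation rC addn1.
have [trx nrelx] := tr n (leqnn n); rewrite rn in trx nrelx.
have unrel := traced_owner _ xS trx nrelx.
have oS : owner x \in S by apply: S_closed unrel.
split; first by rewrite Q_dom.
have inv := execution_invariant E t x.
have dom A : A \in S -> A \in domf (actors (conf E t)).
  by case/S_terminated => -[Phi AP] _; rewrite -fndSome AP.
have ext A : A \in S -> A \notin externals (conf E t).
  by move/dom/(inv_disjoint inv).
have quiet p A : A \in S -> cnt p (undelivered (conf E t)) A = 0.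
  by move/S_terminated/terminated_no_messages; rewrite /cnt => ->; rewrite enum_mset0.
have [crx nrel] := unrel.
(* No release message is in transit to the target, [x] is unreleased, and both ends are internal, so
   the right is still pending. *)
have pend : 0 < pending x (conf E t).
  case: (inv_live inv crx) => [|/nrel //|ex|ex].
  - by rewrite quiet // addn0.
  - by move: (ext _ oS); rewrite ex.
  - by move: (ext _ xS); rewrite ex.
have [m []] := inv_balanced inv (dom _ oS) (ext _ xS) pend.
(* With nothing in flight, the send count equals the receive count [m]. *)
rewrite /in_flight quiet // addn0 => sent recv.
exists m; split; apply/QE => //=.
(* No [App] message is in transit to the owner, so the pending right is its [Activated] fact. *)
by apply: derives_ax; move: pend; rewrite /pending quiet // add0n lt0b.
Qed.
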